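(* Let $p\ge 1$ and, for $j=1,\dots,p$, let $A_j$ be a finite set with $m_j\ge 1$ elements; put $\Omega_p=A_1\times\dots\times A_p$. Let $v>0$, $w>0$. Suppose that, given $\boldsymbol c=(c_1,\dots,c_p)\in\Omega_p$ and $\boldsymbol\sigma=(\sigma_1,\dots,\sigma_p)\in(0,\infty)^p$, the observations $\boldsymbol x_1,\dots,\boldsymbol x_n\in\Omega_p$, $\boldsymbol x_i=(x_{i1},\dots,x_{ip})$, are i.i.d. from the $\mathrm{Hamming}(\boldsymbol c,\boldsymbol\sigma)$ distribution. Suppose that a priori $c_1,\dots,c_p$ are independent, $c_j$ having an arbitrary probability mass function $p(c_j)$ on $A_j$, and that $\sigma_1,\dots,\sigma_p$ are independent of each other and of $\boldsymbol c$, with $\sigma_j\sim\mathrm{HIG}(v,w)$. Then the marginal likelihood of the data (the likelihood integrated with respect to the prior of $(\boldsymbol c,\boldsymbol\sigma)$) is $$p(\boldsymbol x_1,\dots,\boldsymbol x_n)=\sum_{\boldsymbol c\in\Omega_p}\prod_{j=1}^p p(c_j)\,\frac{I_j(v^\ast,w^\ast)}{I_j(v,w)},$$ where $$I_j(v,w)=\frac{m_j^{-(v+w)}}{w+1}\,{}_2F_1\!\left(1,v+w;\,w+2;\,\frac{m_j-1}{m_j}\right)$$ is the normalizing constant of the $\mathrm{HIG}(v,w)$ density and, in the $j$-th factor of the term indexed by $\boldsymbol c$, $v^\ast=v+\sum_{i=1}^n\delta_{c_j}(x_{ij})$ and $w^\ast=w+n-\sum_{i=1}^n\delta_{c_j}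(x_{ij})$.
   Context: $\delta_a(b)$ is the Kronecker delta: it equals $1$ if $a=b$ and $0$ otherwise. ${}_2F_1(a,b;c;z)$ is the Gauss hypergeometric function. The $\mathrm{Hamming}(\boldsymbol c,\boldsymbol\sigma)$ distribution on $\Omega_p$, with center $\boldsymbol c\in\Omega_p$ and scale $\boldsymbol\sigma\in(0,\infty)^p$, has probability mass function $$p(\boldsymbol x\mid\boldsymbol c,\boldsymbol\sigma)=\frac{1}{\prod_{j=1}^p\left(1+\frac{m_j-1}{\exp(1/\sigma_j)}\right)}\exp\!\left(-\sum_{j=1}^p\frac{1-\delta_{c_j}(x_j)}{\sigma_j}\right),\qquad \boldsymbol x=(x_1,\dots,x_p)\in\Omega_p.$$ The Hypergeometric Inverse Gamma distribution $\mathrm{HIG}(v,w)$ for $\sigma_j$ is the probability distribution on $(0,\infty)$ with density $$f(\sigma_j\mid v,w)=\frac{1}{I_j(v,w)}\left(1+\frac{m_j-1}{\exp(1/\sigma_j)}\right)^{-(v+w)}\exp\!\left(-\frac{w+1}{\sigma_j}\right)\frac{1}{\sigma_j^2}.$$ *)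

(* Defs.v *)
From HB Require Import structures.
From mathcomp Require Import all_boot all_order all_algebra.
From mathcomp Require Import all_classical all_reals all_analysis.
Import Order.TTheory GRing.Theory Num.Theory numFieldNormedType.Exports.

Set Implicit Arguments.
Unset Strict Implicit.
Unset Printing Implicit Defensive.

Local Open Scope classical_set_scope.
Local Open Scope ring_scope.

Definition pochhammer (R : realType) (a : R) (k : nat) : R :=
  \prod_(0 <= i < k) (a + i%:R).

(* The defining power series of 2F1(a, b; c; z).  It is only used for
   0 <= z < 1 and c > 0, where it converges. *)
Definition hyp2F1 (R : realType) (a b c z : R) : R :=
  limn (series (fun k : nat =>
    pochhammer a k * pochhammer b k / (pochhammer c k * k`!%:R) * z ^+ k)).

Definition is_pmf (R : realType) (S : finType) (q : S -> R) : Prop :=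
  (forall a, 0 <= q a) /\ \sum_(a : S) q a = 1.

Definition hamming_base (R : realType) (m : nat) (s : R) : R :=
  1 + (m%:R - 1) / expR s^-1.

Section Hamming.
Context {R : realType} {p : nat} {A : 'I_p -> finType}.

Definition Omega : finType := {dffun forall j : 'I_p, A j}.

Definition hamming_pmf (c : Omega) (sigma : 'I_p -> R) (x : Omega) : R :=
  (\prod_(j < p) hamming_base #|A j| (sigma j))^-1 *
  expR (- \sum_(j < p) (1 - (x j == c j)%:R) / sigma j).

Definition likelihood (n : nat) (c : Omega) (sigma : 'I_p -> R)
    (x : 'I_n -> Omega) : R :=
  \prod_(i < n) hamming_pmf c sigma (x i).

Definition matches (n : nat) (x : 'I_n -> Omega) (c : Omega) (j : 'I_p) : nat :=
  (\sum_(i < n) (x i j == c j))%N.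

End Hamming.

Arguments Omega {p} A.

Definition HIG_const (R : realType) (m : nat) (v w : R) : R :=
  m%:R `^ (- (v + w)) / (w + 1) *
  hyp2F1 1 (v + w) (w + 2) ((m%:R - 1) / m%:R).

Definition HIG_kernel (R : realType) (m : nat) (v w s : R) : R :=
  hamming_base m s `^ (- (v + w)) * expR (- ((w + 1) / s)) / s ^+ 2.

Definition HIG_density (R : realType) (m : nat) (v w s : R) : R :=
  (HIG_const m v w)^-1 * HIG_kernel m v w s.

Section Probability.
Context {R : realType} {d : measure_display} {T : measurableType d}.
Variable P : probability T R.

Definition mutually_independent (I : finType) (F : I -> set (set T)) : Prop :=
  forall (J : {set I}) (E : I -> set T),
    (forall i, i \in J -> F i (E i)) ->
    P (\bigcap_(i in [set` J]) E i) = (\prod_(i in J) P (E i))%E.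

(* The law is carried by (0, +oo), so a Y with this law is positive almost
   surely; its values on a null set are unconstrained. *)
Definition has_HIG_law (m : nat) (v w : R) (Y : {RV P >-> R}) : Prop :=
  forall B : set R, measurable B ->
    distribution P Y B =
    (\int[lebesgue_measure]_(s in B `&` `]0%R, +oo[) (HIG_density m v w s)%:E)%E.

Section Model.
Context {p : nat} {A : 'I_p -> finType}.
Variables (c : T -> Omega A) (sigma : 'I_p -> {RV P >-> R}).

(* The finite sets Omega A and A j carry their discrete sigma-algebras: every
   subset is measurable, whence the class [set: set _] of all subsets below. *)
Definition events_of_center : set (set T) := preimage_set_system setT c setT.

Definition events_of_center_coord (j : 'I_p) : set (set T) :=
  preimage_set_system setT (fun t => c t j) setT.

Definition events_of_scale (j : 'I_p) : set (set T) :=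
  preimage_set_system setT (sigma j) measurable.

Definition prior (q : forall j, A j -> R) (v w : R) : Prop :=
  [/\ events_of_center `<=` measurable,
      forall j a, P [set t | c t j = a] = (q j a)%:E,
      mutually_independent events_of_center_coord,
      forall j, has_HIG_law #|A j| v w (sigma j) &
      (* c, sigma_1, ..., sigma_p are independent; None is the index of c. *)
      mutually_independent (fun o : option 'I_p =>
        if o is Some j then events_of_scale j else events_of_center)].

Definition parameter_events : set (set T) :=
  <<s events_of_center `|` \bigcup_j events_of_scale j >>.

(* Given (c, sigma), the X_i are i.i.d. Hamming(c, sigma): the conditional
   probability of X = x given the sigma-algebra of (c, sigma) is a version of
   the product of the Hamming probabilities of the x_i. *)
Definition iid_hamming_given (n : nat) (X : 'I_n -> T -> Omega A) : Prop :=
  (forall i, preimage_set_system setT (X i) setT `<=` measurable) /\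
  forall (x : 'I_n -> Omega A) (G : set T), parameter_events G ->
    P ([set t | forall i, X i t = x i] `&` G) =
    (\int[P]_(t in G) (likelihood (c t) (fun j => sigma j t) x)%:E)%E.

Definition marginal_likelihood (n : nat) (x : 'I_n -> Omega A) : \bar R :=
  (\int[P]_t (likelihood (c t) (fun j => sigma j t) x)%:E)%E.

End Model.
End Probability.

(* Main.v *)
(* With [u = e^(-1/s)] and [h = 1 + (m-1) u], the HIG kernel is [h^-(v+w) u^(w+1) / s^2].
   Integrating by parts against [u^(w+1) / (w+1)] gives, for its integral [J],
     [J v w = m^-(v+w) / (w+1) + (v+w) (m-1) / (w+1) * J v (w+1)],
   and iterating this recurrence produces the partial sums of the 2F1 series directly; the
   remainder tends to 0 because [u/h <= 1/m].
   For the marginal likelihood, the likelihood given a center [c0] is a product over the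
   coordinates of functions of the [sigma_j], so independence turns its expectation into a
   product of one-dimensional integrals; in each, the likelihood factor times the
   HIG(v, w) kernel is the HIG kernel with the updated parameters. *)

Require Import Defs.
From mathcomp Require Import all_boot all_order all_algebra.
From mathcomp Require Import all_classical all_reals all_analysis.
From mathcomp Require Import measurable_realfun ring lra.
Import Order.TTheory GRing.Theory Num.Theory numFieldNormedType.Exports.

Set Implicit Arguments.
Unset Strict Implicit.
Unset Printing Implicit Defensive.

Local Open Scope classical_set_scope.
Local Open Scope ring_scope.

(** * Convergence of the hypergeometric series *)

Lemma pochhammerSr (R : realType) (a : R) k :
  pochhammer a k.+1 = pochhammer a k * (a + k%:R).
Proof. by rewrite /pochhammer big_nat_recr. Qed.

Lemma pochhammerSl (R : realType) (a : R) k :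
  pochhammer a k.+1 = a * pochhammer (a + 1) k.
Proof.
rewrite /pochhammer big_nat_recl//= addr0; congr (_ * _).
by apply: eq_bigr => i _; rewrite -natr1; ring.
Qed.

Lemma pochhammer_gt0 (R : realType) (a : R) k : 0 < a -> 0 < pochhammer a k.
Proof. by move=> a0; apply: prodr_gt0 => i _; rewrite ltr_wpDr. Qed.

Lemma pochhammer1 (R : realType) k : pochhammer (1 : R) k = k`!%:R.
Proof.
elim: k => [|k ih]; first by rewrite /pochhammer big_geq.
by rewrite pochhammerSr ih nat1r -natrM mulnC factS.
Qed.

(** Ratio test: past the threshold [N], the sequence lies between 0 and the geometric sequence
    [a N * r ^+ k]. *)
Lemma cvgn0_ratio (R : realType) (a : nat -> R) (r : R) : 0 <= r < 1 ->
  (forall n, 0 <= a n) -> (\forall n \near \oo, a n.+1 <= r * a n) ->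
  a n @[n --> \oo] --> (0 : R).
Proof.
move=> /andP[r0 r1] a0 [N _ aN].
rewrite -(cvg_shiftn N).
apply: (@squeeze_cvgr _ _ _ _ (cst 0) (fun k => a N * r ^+ k)).
- apply: nearW => k /=; rewrite a0/=; elim: k => [|k ih].
    by rewrite expr0 mulr1.
  rewrite addSn (le_trans (aN _ _))//=; first exact: leq_addl.
  by rewrite exprS mulrCA ler_wpM2l.
- exact: cvg_cst.
- rewrite -[X in _ --> X](mulr0 (a N)); apply: cvgM; first exact: cvg_cst.
  by apply: cvg_expr; rewrite ger0_norm.
Qed.

(** Consecutive terms have ratio [z * (b + n) / (d + n)], which tends to [z], hence is eventually
    below the midpoint [r] of [z] and 1. This makes the remainder of the 2F1 expansion vanish. *)
Lemma cvgn_pochhammer_ratio (R : realType) (b d z : R) :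
  0 < b -> 0 < d -> 0 <= z < 1 ->
  pochhammer b n / pochhammer d n * z ^+ n @[n --> \oo] --> (0 : R).
Proof.
move=> b0 d0 /andP[z0 z1]; pose r := (z + 1) / 2.
have zr : z < r by rewrite /r; lra.
apply: (@cvgn0_ratio _ _ r).
- by rewrite /r; lra.
- by move=> n; rewrite mulr_ge0 ?exprn_ge0// divr_ge0// ltW ?pochhammer_gt0.
near=> n.
have dn : 0 < d + n%:R by rewrite ltr_wpDr.
have h : z * (b + n%:R) <= r * (d + n%:R).
  (* From this threshold on, [z * b <= (r - z) * n], so [z * (b + n) <= r * n <= r * (d + n)]. *)
  have : z * b / (r - z) <= n%:R by near: n; exact: nbhs_infty_ger.
  rewrite ler_pdivrMr ?subr_gt0// => h.
  have : 0 <= r * d by rewrite mulr_ge0// /r; lra.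
  lra.
have p0 := pochhammer_gt0 n d0.
rewrite !pochhammerSr exprS.
rewrite (_ : _ * _ / _ * _ = z * (b + n%:R) / (d + n%:R) *
  (pochhammer b n / pochhammer d n * z ^+ n)); last first.
  by field; rewrite !gt_eqF.
apply: ler_wpM2r.
  by rewrite mulr_ge0 ?exprn_ge0// divr_ge0// ltW ?pochhammer_gt0.
by rewrite ler_pdivrMr.
Unshelve. all: by end_near. Qed.

(** * The normalizing constant of the HIG density *)

(** The half-line is exhausted by the closed [[a + 1/(n+1), +oo[], where the fundamental theorem
    applies, and monotone convergence gives the limit. Only a right limit of [F] at [a] is asked: as
    [0^-1 = 0], the function [expR (- (a / s))] has value 1 at 0, whereas its right limit there is 0
    for positive [a]. *)
Lemma integral_oy_FTC2 (R : realType) (f F : R -> R) (a l0 l1 : R) :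
  (forall x, a < x -> 0 <= f x) ->
  (forall x, a < x -> {for x, continuous f}) ->
  (forall x, a < x -> is_derive x 1 F (f x)) ->
  F x @[x --> a^'+] --> l0 -> F x @[x --> +oo] --> l1 ->
  (\int[lebesgue_measure]_(x in `]a, +oo[) (f x)%:E = (l1 - l0)%:E)%E.
Proof.
move=> f0 cf dF Fl0 Fl1.
pose D n : set R := `[a + n.+1%:R^-1, +oo[%classic.
have aD n : a < a + n.+1%:R^-1 by rewrite ltrDl.
have DE : `]a, +oo[%classic = \bigcup_n D n.
  apply/seteqP; split => x /=; last first.
    by move=> [n _]; rewrite /D /= !in_itv/= !andbT; exact: lt_le_trans.
  rewrite in_itv/= andbT => ax.
  have [n /ltW anx] := ltr_add_invr ax.
  by exists n => //; rewrite /D /= in_itv/= andbT.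
have mf : measurable_fun `]a, +oo[ f.
  apply: open_continuous_measurable_fun => //.
  by move=> x; rewrite inE/= in_itv/= andbT => /cf.
have Fcf x : a < x -> {for x, continuous F}.
  move=> ax; apply: differentiable_continuous; apply/derivable1_diffP.
  by case: (dF _ ax).
have IDn n : (\int[lebesgue_measure]_(x in D n) (f x)%:E = l1%:E - (F (a + n.+1%:R^-1))%:E)%E.
  apply: ge0_continuous_FTC2y => //.
  - by move=> x ax; apply: f0; exact: lt_le_trans ax.
  - apply/continuous_within_itvcyP; split.
      by move=> x; rewrite in_itv/= andbT => ax; apply: cf; exact: lt_trans ax.
    by apply: cvg_at_right_filter; exact: cf.
  - by move=> x ax; case: (dF _ (lt_trans (aD n) ax)).
  - by apply: cvg_at_right_filter; exact: Fcf.
  - move=> x; rewrite in_itv/= andbT => ax; have h := dF _ (lt_trans (aD n) ax).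
    by rewrite derive1E derive_val.
have sDa n : D n `<=` `]a, +oo[ by rewrite DE; exact: bigcup_sup.
have cvgI : (\int[lebesgue_measure]_(x in D n) (f x)%:E)%E @[n --> \oo] -->
    (\int[lebesgue_measure]_(x in \bigcup_n D n) (f x)%:E)%E.
  apply: ge0_nondecreasing_set_cvg_integral.
  - move=> n k nk; rewrite subsetEset; apply: subset_itvr.
    by rewrite bnd_simp lerD2l lef_pV2 ?posrE// ler_nat ltnS.
  - by move=> n; rewrite /D.
  - move=> n; apply/measurable_EFinP; apply: measurable_funS mf => //.
  - by move=> n x /sDa/=; rewrite in_itv/= andbT lee_fin => /f0.
rewrite DE -(cvg_lim _ cvgI)//; apply/cvg_lim => //.
under eq_fun do rewrite IDn -EFinB.
apply: cvg_EFin; first exact: nearW.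
apply: cvgB; first exact: cvg_cst.
apply: (cvg_at_rightP F a l0).1 => //; split; first by move=> n /=; exact: aD.
rewrite -[X in _ --> X]addr0; apply: cvgD; first exact: cvg_cst.
apply/cvgrPdist_lt => e e0; rewrite /=.
have := @near_infty_natSinv_lt R (PosNum e0); apply: filterS => n /=.
by rewrite sub0r normrN gtr0_norm.
Qed.

(** * The exponential [expR (- (a / s))]: derivative, limits and integral *)

Lemma is_derive_expR_divN (R : realType) (a s : R) : s != 0 ->
  is_derive s 1 (fun t => expR (- (a / t))) (a * expR (- (a / s)) / s ^+ 2).
Proof.
move=> s0.
have dV : is_derive s 1 (fun t : R => - (a / t)) (a / s ^+ 2).
  have dV := @is_deriveV R id s 1 1 s0 (is_derive_id _ _).
  have -> : (fun t : R => - (a / t)) = (- a) \*: (fun t : R => t^-1).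
    by apply/funext => t; rewrite -mulNr.
  apply: is_derive_eq; rewrite /=.
  by rewrite /GRing.scale/=; ring.
have := @is_derive1_comp R expR _ s _ _ (is_derive_expR _) dV.
by move=> h; apply: is_derive_eq h _; ring.
Qed.

Lemma measurable_expR_divN (R : realType) (a : R) :
  measurable_fun `](0 : R), +oo[ (fun s => (expR (- (a / s)) / s ^+ 2)%:E).
Proof.
apply/measurable_EFinP; apply: open_continuous_measurable_fun => // s.
rewrite inE/= in_itv/= andbT => s0; apply: cvgM.
  have [] := is_derive_expR_divN a (lt0r_neq0 s0).
  by move=> /derivable1_diffP/differentiable_continuous.
by apply: cvgV; [rewrite expf_neq0// gt_eqF|exact: exprn_continuous].
Qed.

Lemma cvg_expR_divN_at0 (R : realType) (a : R) : 0 < a ->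
  expR (- (a / s)) @[s --> 0^'+] --> 0.
Proof.
move=> a0; apply: (cvg_comp (fun s : R => a / s) (fun y => expR (- y))); last first.
  exact: cvgr_expR.
apply: gt0_cvgMry => //.
apply/cvgrVy; last exact: cvg_at_right_filter.
by near=> s; near: s; exact: nbhs_right_gt.
Unshelve. all: by end_near. Qed.

Lemma cvg_expR_divN_y (R : realType) (a : R) :
  expR (- (a / s)) @[s --> +oo] --> (1 : R).
Proof.
rewrite -(expR0 R).
apply: (cvg_comp (fun s : R => - (a / s)) expR); last exact: continuous_expR.
rewrite -oppr0; apply: cvgN; rewrite -(mulr0 a); apply: cvgM; first exact: cvg_cst.
apply/gtr0_cvgV0 => //; near=> s; near: s; exact: nbhs_pinfty_gt.
Unshelve. all: by end_near. Qed.

(** The antiderivative [a^-1 * expR (- (a / s))] rises from 0 to [a^-1]. The integrand later serves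
    as an integrable majorant of the HIG kernel. *)
Lemma integral_expR_divN (R : realType) (a : R) : 0 < a ->
  (\int[lebesgue_measure]_(s in `]0%R, +oo[)
     (expR (- (a / s)) / s ^+ 2)%:E = a^-1%:E)%E.
Proof.
move=> a0.
rewrite -[in RHS](subr0 a^-1).
apply: (@integral_oy_FTC2 R _ (fun s => a^-1 * expR (- (a / s)))).
- by move=> s s0; rewrite mulr_ge0// ?expR_ge0// invr_ge0 exprn_ge0// ltW.
- move=> s s0; apply: cvgM.
    have [] := is_derive_expR_divN a (lt0r_neq0 s0).
    by move=> /derivable1_diffP/differentiable_continuous.
  apply: cvgV; first by rewrite expf_neq0// gt_eqF.
  exact: exprn_continuous.
- move=> s s0; have h := is_derive_expR_divN a (lt0r_neq0 s0).
  apply: is_derive_eq; rewrite /GRing.scale/=.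
  by field; rewrite !lt0r_neq0.
- rewrite -[X in _ --> X](mulr0 a^-1); apply: cvgM; first exact: cvg_cst.
  exact: cvg_expR_divN_at0.
- rewrite -[X in _ --> X](mulr1 a^-1); apply: cvgM; first exact: cvg_cst.
  exact: cvg_expR_divN_y.
Qed.

(** * Derivative, limits and bounds of the HIG kernel *)

Section HIG_integral.
Variables (R : realType) (m : nat).
Hypothesis m_gt0 : (0 < m)%N.
Implicit Types (v w s : R).

Lemma hamming_baseE s : hamming_base m s = 1 + (m%:R - 1) * expR (- (1 / s)).
Proof. by rewrite /hamming_base -expRN mul1r. Qed.

Lemma subr_natr1_ge0 : 0 <= m%:R - 1 :> R.
Proof. by rewrite subr_ge0 ler1n. Qed.

Lemma hamming_base_ge1 s : 1 <= hamming_base m s.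
Proof. by rewrite lerDl mulr_ge0 ?subr_natr1_ge0// invr_ge0 expR_ge0. Qed.

Lemma hamming_base_gt0 s : 0 < hamming_base m s.
Proof. exact: lt_le_trans (hamming_base_ge1 s). Qed.

Lemma is_derive_hamming_base s : s != 0 ->
  is_derive s 1 (@hamming_base R m) ((m%:R - 1) * expR (- (1 / s)) / s ^+ 2).
Proof.
move=> s0; have h := is_derive_expR_divN 1 s0.
rewrite (_ : @hamming_base R m = cst 1 + (m%:R - 1) \*: (fun t : R => expR (- (1 / t)))).
  by apply: is_derive_eq; rewrite /GRing.scale/=; ring.
by apply/funext => t; rewrite hamming_baseE.
Qed.

Lemma is_derive_hamming_base_powR (b s : R) : s != 0 ->
  is_derive s 1 (fun t => hamming_base m t `^ (- b))
    (- b * hamming_base m s `^ (- b - 1) *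
      ((m%:R - 1) * expR (- (1 / s)) / s ^+ 2)).
Proof.
move=> s0; have := is_derive_hamming_base s0.
exact: (@is_derive1_comp R (fun y => y `^ (- b)) _ s _ _
  (is_derive1_powR (- b) (hamming_base_gt0 s))).
Qed.

Lemma HIG_kernel_ge0 v w s : 0 <= HIG_kernel m v w s.
Proof.
apply: divr_ge0; last exact: sqr_ge0.
by rewrite mulr_ge0 ?powR_ge0 ?expR_ge0.
Qed.

(** This is the integration by parts in differential form. Differentiating the exponential gives the
    kernel itself; differentiating the power of the base lowers its exponent by one and brings out
    one more [expR (- (1 / s))], which is the kernel at [w + 1]. *)
Lemma is_derive_HIG_antiderivative v w s : 0 < s -> w + 1 != 0 ->
  is_derive s 1
    (fun t => hamming_base m t `^ (- (v + w)) * expR (- ((w + 1) / t)) / (w + 1))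
    (HIG_kernel m v w s -
     (v + w) * (m%:R - 1) / (w + 1) * HIG_kernel m v (w + 1) s).
Proof.
move=> s0 w1.
have d1 := is_derive_hamming_base_powR (v + w) (lt0r_neq0 s0).
have d2 := is_derive_expR_divN (w + 1) (lt0r_neq0 s0).
rewrite (_ : (fun _ => _) = (w + 1)^-1 \*:
    ((fun t => hamming_base m t `^ (- (v + w))) *
     (fun t => expR (- ((w + 1) / t))))); last first.
  by apply/funext => t; rewrite mulrC.
apply: is_derive_eq; rewrite /HIG_kernel /GRing.scale/=.
rewrite (_ : - (v + (w + 1)) = - (v + w) - 1); last by ring.
rewrite (_ : - ((w + 1 + 1) / s) = - ((w + 1) / s) + - (1 / s)); last by ring.
by rewrite expRD; field; rewrite w1 lt0r_neq0.
Qed.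

Lemma continuous_HIG_kernel v w s : 0 < s ->
  {for s, continuous (@HIG_kernel R m v w)}.
Proof.
move=> s0; have s1 := lt0r_neq0 s0; apply: cvgM; last first.
  by apply: cvgV; [rewrite expf_neq0|exact: exprn_continuous].
apply: cvgM.
  have [] := is_derive_hamming_base_powR (v + w) s1.
  by move=> /derivable1_diffP/differentiable_continuous.
have [] := is_derive_expR_divN (w + 1) s1.
by move=> /derivable1_diffP/differentiable_continuous.
Qed.

Lemma cvg_hamming_base_powR_at0 (b : R) :
  hamming_base m s `^ (- b) @[s --> 0^'+] --> (1 : R).
Proof.
rewrite (_ : 1 = 1 `^ (- b)); last by rewrite powR1.
have h : hamming_base m s @[s --> 0^'+] --> (1 : R).
  rewrite [X in _ --> X](_ : _ = 1 + (m%:R - 1) * 0); last by ring.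
  under eq_fun do rewrite hamming_baseE.
  apply: cvgD; first exact: cvg_cst.
  by apply: cvgM; [exact: cvg_cst|exact: cvg_expR_divN_at0].
apply: (cvg_comp _ (fun y => y `^ (- b)) h).
have [] := is_derive1_powR (- b) (@ltr01 R).
by move=> /derivable1_diffP/differentiable_continuous.
Qed.

Lemma cvg_hamming_base_powR_y (b : R) :
  hamming_base m s `^ (- b) @[s --> +oo] --> m%:R `^ (- b).
Proof.
have h : hamming_base m s @[s --> +oo] --> (m%:R : R).
  rewrite [X in _ --> X](_ : _ = 1 + (m%:R - 1) * 1); last by ring.
  under eq_fun do rewrite hamming_baseE.
  apply: cvgD; first exact: cvg_cst.
  by apply: cvgM; [exact: cvg_cst|exact: cvg_expR_divN_y].
apply: (cvg_comp _ (fun y => y `^ (- b)) h).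
have m0 : 0 < m%:R :> R by rewrite ltr0n.
have [] := is_derive1_powR (- b) m0.
by move=> /derivable1_diffP/differentiable_continuous.
Qed.

Lemma powR_hamming_base_le1 (b s : R) : 0 <= b -> hamming_base m s `^ (- b) <= 1.
Proof.
move=> b0; rewrite powRN invf_le1 ?powR_gt0 ?hamming_base_gt0//.
by rewrite -(powRr0 (hamming_base m s)) ler_powR ?hamming_base_ge1.
Qed.

Lemma HIG_kernel_le v w s : 0 <= v + w ->
  HIG_kernel m v w s <= expR (- ((w + 1) / s)) / s ^+ 2.
Proof.
move=> b0; rewrite ler_wpM2r ?invr_ge0 ?sqr_ge0// ler_piMl ?expR_ge0//.
exact: powR_hamming_base_le1.
Qed.

Lemma HIG_kernelS v w s :
  HIG_kernel m v (w + 1) s =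
  HIG_kernel m v w s * (expR (- (1 / s)) / hamming_base m s).
Proof.
have h0 := hamming_base_gt0 s.
rewrite /HIG_kernel addrA opprD powRD ?lt0r_neq0 ?implybT//.
rewrite powR_inv1 ?(ltW h0)//.
rewrite (_ : - ((w + 1 + 1) / s) = - ((w + 1) / s) + - (1 / s)); last by ring.
by rewrite expRD; ring.
Qed.

(** With [u = expR (- (1 / s))], the bound [u / (1 + (m - 1) u) <= 1 / m] amounts to [u <= 1]. *)
Lemma HIG_kernelS_le v w s : 0 < s ->
  HIG_kernel m v (w + 1) s <= HIG_kernel m v w s / m%:R.
Proof.
move=> s0; rewrite HIG_kernelS ler_wpM2l ?HIG_kernel_ge0//.
rewrite ler_pdivrMr ?hamming_base_gt0// [leRHS]mulrC ler_pdivlMr ?ltr0n//.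
have : expR (- (1 / s)) <= 1 by rewrite -expR0 ler_expR oppr_le0 divr_ge0// ltW.
by rewrite hamming_baseE; lra.
Qed.

Lemma measurable_HIG_kernel v w :
  measurable_fun `](0 : R), +oo[ (EFin \o @HIG_kernel R m v w).
Proof.
apply/measurable_EFinP; apply: open_continuous_measurable_fun => // s.
by rewrite inE/= in_itv/= andbT; exact: continuous_HIG_kernel.
Qed.

(** * The integral of the HIG kernel: recurrence and hypergeometric expansion *)

Let J v w : \bar R :=
  (\int[lebesgue_measure]_(s in `]0%R, +oo[) (HIG_kernel m v w s)%:E)%E.

Lemma integral_HIG_kernel_ge0 v w : (0 <= J v w)%E.
Proof. by apply: integral_ge0 => s _; rewrite lee_fin HIG_kernel_ge0. Qed.

Lemma integral_HIG_kernel_fin v w : 0 <= v + w -> 0 < w + 1 ->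
  J v w \is a fin_num.
Proof.
move=> vw w1; rewrite ge0_fin_numE ?integral_HIG_kernel_ge0//.
apply: (@le_lt_trans _ _ (w + 1)^-1%:E); last by rewrite ltry.
rewrite -integral_expR_divN//; apply: ge0_le_integral => //.
- by move=> s _; rewrite lee_fin HIG_kernel_ge0.
- exact: measurable_HIG_kernel.
- exact: measurable_expR_divN.
- by move=> s _; rewrite lee_fin HIG_kernel_le.
Qed.

(* The derivative of the antiderivative is signed; adding [C e^(-(w+2)/s) / s^2] makes it
   nonnegative, so that the fundamental theorem for nonnegative integrands applies. *)
Lemma integral_HIG_kernel_rec v w : 0 <= v + w -> 0 < w + 1 ->
  fine (J v w) = m%:R `^ (- (v + w)) / (w + 1) +
    (v + w) * (m%:R - 1) / (w + 1) * fine (J v (w + 1)).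
Proof.
move=> vw w1; set C := (v + w) * (m%:R - 1) / (w + 1).
have w2 : 0 < w + 1 + 1 by rewrite ltr_wpDr.
have vw1 : 0 <= v + (w + 1) by rewrite addrA ltW// ltr_wpDl.
have C0 : 0 <= C by rewrite mulr_ge0 ?mulr_ge0 ?invr_ge0 ?subr_natr1_ge0// ltW.
pose E s : R := expR (- ((w + 1 + 1) / s)) / s ^+ 2.
pose g s : R := HIG_kernel m v w s - C * HIG_kernel m v (w + 1) s + C * E s.
have E0 s : 0 <= E s by rewrite divr_ge0 ?expR_ge0 ?sqr_ge0.
(* The kernel at [w + 1] is bounded by [E], so the last two terms of [g] have a nonnegative sum. *)
have g0 s : 0 <= g s.
  rewrite /g -addrA addr_ge0 ?HIG_kernel_ge0// addrC subr_ge0 ler_wpM2l//.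
  exact: HIG_kernel_le.
have cE s : 0 < s -> {for s, continuous E}.
  move=> s0; apply: cvgM.
    have [] := is_derive_expR_divN (w + 1 + 1) (lt0r_neq0 s0).
    by move=> /derivable1_diffP/differentiable_continuous.
  by apply: cvgV; [rewrite expf_neq0// gt_eqF|exact: exprn_continuous].
have cg s : 0 < s -> {for s, continuous g}.
  move=> s0; apply: cvgD; last by apply: cvgM; [exact: cvg_cst|exact: cE].
  apply: cvgB; first exact: continuous_HIG_kernel.
  by apply: cvgM; [exact: cvg_cst|exact: continuous_HIG_kernel].
have mg : measurable_fun `](0 : R), +oo[ (EFin \o g).
  apply/measurable_EFinP; apply: open_continuous_measurable_fun => // s.
  by rewrite inE/= in_itv/= andbT; exact: cg.
have Ig : (\int[lebesgue_measure]_(s in `]0%R, +oo[) (g s)%:E =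
    (m%:R `^ (- (v + w)) / (w + 1) + C / (w + 1 + 1))%:E)%E.
  rewrite -[X in X%:E]subr0.
  apply: (@integral_oy_FTC2 R _ (fun s =>
    hamming_base m s `^ (- (v + w)) * expR (- ((w + 1) / s)) / (w + 1) +
    C / (w + 1 + 1) * expR (- ((w + 1 + 1) / s)))) => //.
  - move=> s s0.
    have d1 := @is_derive_HIG_antiderivative v w _ s0 (lt0r_neq0 w1).
    have d2 := is_derive_expR_divN (w + 1 + 1) (lt0r_neq0 s0).
    apply: is_derive_eq; rewrite /g /E /GRing.scale/=.
    by rewrite /C; field; rewrite !lt0r_neq0.
  - rewrite [X in _ --> X](_ : _ = 1 * 0 / (w + 1) + C / (w + 1 + 1) * 0); last by ring.
    apply: cvgD; apply: cvgM; try exact: cvg_cst; last exact: cvg_expR_divN_at0.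
    by apply: cvgM; [exact: cvg_hamming_base_powR_at0|exact: cvg_expR_divN_at0].
  - rewrite [X in _ --> X](_ : _ =
      m%:R `^ (- (v + w)) * 1 / (w + 1) + C / (w + 1 + 1) * 1); last by ring.
    apply: cvgD; apply: cvgM; try exact: cvg_cst; last exact: cvg_expR_divN_y.
    by apply: cvgM; [exact: cvg_hamming_base_powR_y|exact: cvg_expR_divN_y].
(* The negative term of [g] is moved to the other side, so that only nonnegative integrands are
   added; finiteness then allows solving for [J v w] in the reals. *)
have : (J v w + C%:E * (w + 1 + 1)^-1%:E =
    (m%:R `^ (- (v + w)) / (w + 1) + C / (w + 1 + 1))%:E + C%:E * J v (w + 1))%E.
  rewrite -(integral_expR_divN w2) -Ig /J -!ge0_integralZl_EFin//; last 4 first.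
  - by move=> s _; rewrite lee_fin HIG_kernel_ge0.
  - exact: measurable_HIG_kernel.
  - by move=> s _; rewrite lee_fin E0.
  - exact: measurable_expR_divN.
  rewrite -!ge0_integralD//; first last.
  - by apply: measurable_funeM; exact: measurable_expR_divN.
  - by move=> s _; rewrite lee_fin mulr_ge0 ?E0.
  - exact: measurable_HIG_kernel.
  - by move=> s _; rewrite lee_fin HIG_kernel_ge0.
  - by apply: measurable_funeM; exact: measurable_HIG_kernel.
  - by move=> s _; rewrite lee_fin mulr_ge0 ?HIG_kernel_ge0.
  - by move=> s _; rewrite lee_fin.
  by apply: eq_integral => s _; rewrite -!EFinM -!EFinD /g /E; congr EFin; ring.
rewrite -{1}(fineK (integral_HIG_kernel_fin vw w1)).
rewrite -{1}(fineK (integral_HIG_kernel_fin vw1 w2)).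
by rewrite -!EFinM -!EFinD => -[/eqP]; lra.
Qed.

Lemma integral_HIG_kernelS_le v w : 0 <= v + w -> 0 < w + 1 ->
  fine (J v (w + 1)) <= fine (J v w) / m%:R.
Proof.
move=> vw w1.
have w2 : 0 < w + 1 + 1 by rewrite ltr_wpDr.
have vw1 : 0 <= v + (w + 1) by rewrite addrA ltW// ltr_wpDl.
rewrite -lee_fin EFinM !fineK ?integral_HIG_kernel_fin// muleC.
rewrite -ge0_integralZl_EFin//; first last.
- exact: measurable_HIG_kernel.
- by move=> s _; rewrite lee_fin HIG_kernel_ge0.
apply: ge0_le_integral => //.
- by move=> s _; rewrite lee_fin HIG_kernel_ge0.
- exact: measurable_HIG_kernel.
- by apply: measurable_funeM; exact: measurable_HIG_kernel.
- move=> s /=; rewrite in_itv/= andbT => s0.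
  by rewrite -EFinM lee_fin mulrC HIG_kernelS_le.
Qed.

Lemma integral_HIG_kernel_iter_le v w k : 0 <= v + w -> 0 < w + 1 ->
  fine (J v (w + k%:R)) <= fine (J v w) / m%:R ^+ k.
Proof.
move=> vw w1; elim: k => [|k ih]; first by rewrite addr0 expr0 divr1.
have k0 : 0 <= k%:R :> R by [].
rewrite -natr1 addrA; apply: le_trans (integral_HIG_kernelS_le _ _) _.
- by rewrite addrA addr_ge0.
- by rewrite addrAC ltr_wpDr.
by rewrite exprSr invfM mulrA ler_wpM2r ?invr_ge0.
Qed.

(** The recurrence is unrolled [k] times. The sum has Pochhammer symbols at [w + 2] because one
    factor [1 / (w + 1)] is taken out in front, while the remainder keeps it and so has them at
    [w + 1]. *)
Lemma integral_HIG_kernel_expansion v w k : 0 <= v + w -> 0 < w + 1 ->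
  fine (J v w) = m%:R `^ (- (v + w)) / (w + 1) *
      \sum_(0 <= i < k) (pochhammer (v + w) i / pochhammer (w + 2) i *
                         ((m%:R - 1) / m%:R) ^+ i) +
    pochhammer (v + w) k / pochhammer (w + 1) k * (m%:R - 1) ^+ k *
      fine (J v (w + k%:R)).
Proof.
move=> vw w1; elim: k => [|k ih].
  by rewrite big_geq// mulr0 add0r /pochhammer !big_geq// divr1 expr0 !mul1r addr0.
have k0 : 0 <= k%:R :> R by [].
have m0 : m%:R != 0 :> R by rewrite pnatr_eq0 -lt0n.
have w1k : 0 < w + k%:R + 1 by rewrite addrAC ltr_wpDr.
have p1 : pochhammer (w + 1) k != 0 by rewrite gt_eqF// pochhammer_gt0.
have p2 : pochhammer (w + 2) k = pochhammer (w + 1) k * (w + k%:R + 1) / (w + 1).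
  rewrite addrAC -pochhammerSr pochhammerSl -addrA.
  by rewrite mulrAC divff ?mul1r// gt_eqF.
have Em : m%:R `^ (- (v + (w + k%:R))) = m%:R `^ (- (v + w)) / m%:R ^+ k :> R.
  by rewrite addrA opprD powRD ?m0 ?implybT// powR_invn.
rewrite {}ih big_nat_recr//= (integral_HIG_kernel_rec (w := w + k%:R))//; last first.
  by rewrite addrA addr_ge0.
rewrite Em p2 expr_div_n !pochhammerSr exprSr -[k.+1%:R]natr1 [w + (k%:R + 1)]addrA.
set S := \sum_(_ <= _ < _) _.
by field; rewrite p1 expf_neq0// addrAC !gt_eqF.
Qed.

Lemma integral_HIG_kernel v w : 0 < v -> 0 < w ->
  J v w = (HIG_const m v w)%:E.
Proof.
move=> v0 w0; have vw : 0 < v + w by exact: addr_gt0.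
have w1 : 0 < w + 1 by exact: addr_gt0.
have m0 : 0 < m%:R :> R by rewrite ltr0n.
rewrite -(fineK (integral_HIG_kernel_fin (ltW vw) w1)); congr EFin.
set c := m%:R `^ (- (v + w)) / (w + 1).
have c0 : c != 0 by rewrite gt_eqF// divr_gt0 ?powR_gt0.
set z : R := (m%:R - 1) / m%:R.
have z01 : 0 <= z < 1.
  rewrite divr_ge0 ?subr_natr1_ge0//= ltr_pdivrMr//; lra.
(* The remainder after [k] terms. The iterated bound on the integral supplies [m ^- k], which turns
   [(m - 1) ^+ k] into [z ^+ k]. *)
pose r k := pochhammer (v + w) k / pochhammer (w + 1) k * (m%:R - 1) ^+ k *
  fine (J v (w + k%:R)).
have r0 : r n @[n --> \oo] --> (0 : R).
  apply: (@squeeze_cvgr _ _ _ _ (cst 0)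
    (fun k => fine (J v w) * (pochhammer (v + w) k / pochhammer (w + 1) k * z ^+ k))).
  - apply: nearW => k /=; rewrite /r.
    have p0 : 0 <= pochhammer (v + w) k / pochhammer (w + 1) k * (m%:R - 1) ^+ k.
      rewrite mulr_ge0 ?exprn_ge0 ?subr_natr1_ge0//.
      by rewrite divr_ge0// ltW ?pochhammer_gt0.
    rewrite mulr_ge0 ?fine_ge0 ?integral_HIG_kernel_ge0//=.
    apply: le_trans (ler_wpM2l p0 (integral_HIG_kernel_iter_le k (ltW vw) w1)) _.
    by rewrite expr_div_n le_eqVlt; apply/orP; left; apply/eqP; ring.
  - exact: cvg_cst.
  - rewrite -[X in _ --> X](mulr0 (fine (J v w))); apply: cvgM; first exact: cvg_cst.
    exact: cvgn_pochhammer_ratio.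
rewrite /HIG_const -/c -/z.
suff -> : hyp2F1 1 (v + w) (w + 2) z = fine (J v w) / c by rewrite mulrC divfK.
apply/cvg_lim => //.
rewrite (_ : series _ = fun k => (fine (J v w) - r k) / c).
  rewrite -[X in _ --> X / c]subr0; apply: cvgM; last exact: cvg_cst.
  by apply: cvgB; [exact: cvg_cst|exact: r0].
apply/funext => k; rewrite (integral_HIG_kernel_expansion k (ltW vw) w1) -/c -/z.
rewrite addrK [RHS]mulrC mulKf// /series/=; apply: eq_bigr => i _.
(* Since the first parameter is 1, its Pochhammer symbol cancels the factorial of the series. *)
have i0 : i`!%:R != 0 :> R by rewrite pnatr_eq0 -lt0n fact_gt0.
have pi0 : pochhammer (w + 2) i != 0 by rewrite gt_eqF// pochhammer_gt0 ?addr_gt0.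
by rewrite pochhammer1; field; rewrite i0 pi0.
Qed.

End HIG_integral.

(** * Integrals against laws and independence *)

Section integral_density_comp.
Import HBNNSimple.

(** An identity known for indicators extends to simple functions by linearity and to nonnegative
    measurable ones by monotone convergence. The map [Y], weight [H] and constant [k] allow two
    uses: integrating against a law with a density ([Y] the identity, [k = 1]), and replacing an
    indicator by a function in a product of independent factors ([H] the other factors, [k] the
    product of their expectations). *)
Lemma ge0_integral_density_comp (R : realType) (d d' : measure_display)
    (T : measurableType d) (U : measurableType d')
    (mu : {measure set T -> \bar R}) (nu : {measure set U -> \bar R})
    (D : set T) (Y : T -> U) (H : T -> R) (k : R) (g : U -> R) :
  measurable D -> measurable_fun D Y -> measurable_fun D H ->
  (forall t, D t -> 0 <= H t) -> 0 <= k ->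
  (forall B, measurable B ->
    k%:E * nu B = \int[mu]_(t in D) (\1_B (Y t) * H t)%:E)%E ->
  measurable_fun setT g -> (forall u, 0 <= g u) ->
  (k%:E * \int[nu]_u (g u)%:E = \int[mu]_(t in D) (g (Y t) * H t)%:E)%E.
Proof.
move=> mD mY mH H0 k0 kB mg g0.
have mge : measurable_fun setT (EFin \o g) by exact/measurable_EFinP.
pose f_ := nnsfun_approx measurableT mge.
have mfY (h : {nnsfun U >-> R}) : measurable_fun D (fun t => h (Y t)).
  exact: measurableT_comp.
have ndf u : {homo f_ ^~ u : a b / (a <= b)%N >-> a <= b}.
  by move=> a b ab; exact/lefP/nd_nnsfun_approx.
have cvf u : (f_ n u)%:E @[n --> \oo] --> (g u)%:E.
  by apply: (cvg_nnsfun_approx measurableT mge) => // v _; rewrite lee_fin.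
have simple (h : {nnsfun U >-> R}) :
    (k%:E * \int[nu]_u (h u)%:E = \int[mu]_(t in D) (h (Y t) * H t)%:E)%E.
  transitivity (\sum_(r \in range h) (r%:E * (k%:E * nu (h @^-1` [set r]))))%E.
    under eq_integral do rewrite fimfunE -fsumEFin//.
    rewrite ge0_integral_fsum//; last 2 first.
    - by move=> r; apply/measurable_EFinP; exact: measurable_funM.
    - by move=> r u _; rewrite EFinM nnfun_muleindic_ge0.
    rewrite ge0_mule_fsumr; last first.
      by move=> r; apply: integral_ge0 => u _; rewrite EFinM nnfun_muleindic_ge0.
    apply: eq_fsbigr => r _.
    by rewrite integralZl_indic_nnsfun// integral_indic// setIT muleCA.
  have mi r : measurable_fun D (fun t => \1_(h @^-1` [set r]) (Y t) * H t).
    apply: measurable_funM => //.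
    have mI : measurable_fun setT (\1_(h @^-1` [set r]) : U -> R).
      exact: measurable_indic.
    exact: (measurableT_comp mI mY).
  transitivity (\int[mu]_(t in D) \sum_(r \in range h)
     (r%:E * (\1_(h @^-1` [set r]) (Y t) * H t)%:E))%E; last first.
    apply: eq_integral => t _; rewrite [in RHS]fimfunE.
    rewrite EFinM -fsumEFin// ge0_mule_fsuml; last first.
      by move=> r; rewrite EFinM nnfun_muleindic_ge0.
    by apply: eq_fsbigr => r _; rewrite -!EFinM mulrA.
  rewrite ge0_integral_fsum//; last 2 first.
  - by move=> r; apply: measurable_funeM; exact/measurable_EFinP.
  - move=> r t Dt; rewrite EFinM muleA; apply: mule_ge0.
      by rewrite nnfun_muleindic_ge0.
    by rewrite lee_fin H0.
  (* As a value of [h], the scalar is nonnegative and may be pulled out of the integral. *)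
  apply: eq_fsbigr => r; rewrite inE => -[u _ <-].
  rewrite kB// ge0_integralZl_EFin//.
  - by move=> t Dt; rewrite lee_fin mulr_ge0// H0.
  - exact/measurable_EFinP.
transitivity (limn (fun n => k%:E * \int[nu]_u (f_ n u)%:E))%E.
  rewrite limeMl//; last first.
    apply/ereal_nondecreasing_is_cvgn => a b ab; apply: ge0_le_integral => //.
    - by move=> x _; rewrite lee_fin.
    - exact/measurable_EFinP.
    - exact/measurable_EFinP.
    - by move=> x _; rewrite lee_fin; exact: ndf.
  congr (_ * _)%E; rewrite -monotone_convergence//=.
  - by apply: eq_integral => u _; apply/esym/cvg_lim => //; exact: cvf.
  - by move=> n; exact/measurable_EFinP.
  - by move=> n u _; rewrite lee_fin.
  - by move=> u _ a b ab; rewrite lee_fin; exact: ndf.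
under eq_fun do rewrite simple.
rewrite -monotone_convergence//=.
- apply: eq_integral => t; rewrite inE => Dt; apply/cvg_lim => //.
  under eq_fun do rewrite EFinM.
  rewrite EFinM; apply: cvgeZr => //; exact: cvf.
- by move=> n; apply/measurable_EFinP; apply: measurable_funM.
- by move=> n t Dt; rewrite lee_fin mulr_ge0// H0.
- by move=> t Dt a b ab; rewrite lee_fin ler_wpM2r ?H0//; exact: ndf.
Qed.

End integral_density_comp.

(** The event [C] will be that of a given center. Finiteness of the expectations makes the product
    of all but one of them a real constant. *)
Lemma integral_prod_independent (R : realType) (d : measure_display)
    (T : measurableType d) (P : probability T R) (I : finType) (C : set T)
    (Y : I -> {RV P >-> R}) (g : I -> R -> R) :
  measurable C ->
  (forall B : I -> set R, (forall i, measurable (B i)) ->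
    P (C `&` \bigcap_i Y i @^-1` B i) = (P C * \prod_i P (Y i @^-1` B i))%E) ->
  (forall i, measurable_fun setT (g i)) -> (forall i x, 0 <= g i x) ->
  (forall i, \int[P]_t (g i (Y i t))%:E < +oo)%E ->
  (\int[P]_t (\1_C t * \prod_i g i (Y i t))%:E =
   P C * \prod_i \int[P]_t (g i (Y i t))%:E)%E.
Proof.
move=> mC indep.
(* Starting from indicators, the [g i] are replaced by arbitrary functions, one index
   at a time. *)
suff H (s : seq I) : forall g : I -> R -> R,
    (forall i, i \notin s -> exists2 B, measurable B & g i = \1_B) ->
    (forall i, measurable_fun setT (g i)) -> (forall i x, 0 <= g i x) ->
    (forall i, \int[P]_t (g i (Y i t))%:E < +oo)%E ->
    (\int[P]_t (\1_C t * \prod_i g i (Y i t))%:E =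
     P C * \prod_i \int[P]_t (g i (Y i t))%:E)%E.
  by apply: (H (enum I)) => i; rewrite mem_enum.
elim: s => [|i0 s ih] {}g gs mg g0 gfin.
  have /boolp.choice[B /all_and2[mB gB]] i : exists B, measurable B /\ g i = \1_B.
    by have [//|B mB gB] := gs i; exists B.
  transitivity (\int[P]_t (\1_(C `&` \bigcap_i Y i @^-1` B i) t)%:E)%E.
    apply: eq_integral => t _; congr EFin.
    rewrite indicI/=; congr (_ * _); under eq_bigr do rewrite gB indicE.
    rewrite indicE; case: (pselect ((\bigcap_i Y i @^-1` B i) t)) => h.
      by rewrite mem_set// big1// => i _; rewrite mem_set//; exact: h.
    rewrite memNset//; have [i nBi] : exists i, ~ B i (Y i t).
      by apply: contrapT => /forallNP hB; apply: h => i _; exact: contrapT (hB i).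
    by rewrite (bigD1 i)//= memNset// mul0r.
  have mYB i : measurable (Y i @^-1` B i).
    by rewrite -[X in measurable X]setTI; exact: measurable_funP.
  rewrite integral_indic//; last first.
    by apply: measurableI => //; apply: fin_bigcap_measurable.
  rewrite setIT; apply: (etrans (indep B mB)).
  congr (_ * _)%E; apply: eq_bigr => i _; rewrite gB.
  by rewrite -(setIT (Y i @^-1` B i)) -integral_indic.
pose F i := (\int[P]_t (g i (Y i t))%:E)%E.
have F0 i : (0 <= F i)%E by apply: integral_ge0 => t _; rewrite lee_fin.
have Ffin i : F i \is a fin_num by rewrite ge0_fin_numE//; exact: gfin.
have PCfin : P C \is a fin_num by rewrite fin_num_measure.
pose H t := \1_C t * \prod_(i | i != i0) g i (Y i t).
pose k := fine (P C) * \prod_(i | i != i0) fine (F i).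
have kE : k%:E = (P C * \prod_(i | i != i0) F i)%E.
  rewrite EFinM fineK// -prodEFin; congr (_ * _)%E.
  by apply: eq_bigr => i _; rewrite fineK.
transitivity (k%:E * \int[distribution P (Y i0)]_u (g i0 u)%:E)%E; last first.
  have mgi : measurable_fun setT (EFin \o g i0) by exact/measurable_EFinP.
  rewrite (ge0_integral_distribution _ mgi)//; last by move=> u; rewrite lee_fin.
  by rewrite kE [in RHS](bigD1 i0)//= -muleA; congr (_ * _)%E; exact: muleC.
have mH : measurable_fun setT H.
  have mC1 : measurable_fun setT (\1_C : T -> R).
    exact: measurable_indic.
  apply: (measurable_funM mC1).
  under eq_fun do rewrite big_mkcond/=.
  apply: (@measurable_prod _ _ _ _ _ _
    (fun i t => if i != i0 then g i (Y i t) else 1)) => i _.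
  by case: (i != i0); [exact: (measurableT_comp (mg i))|exact: measurable_cst].
have H0 t : setT t -> 0 <= H t by move=> _; rewrite mulr_ge0// prodr_ge0.
have k0 : 0 <= k by rewrite mulr_ge0 ?fine_ge0// prodr_ge0// => i _; exact: fine_ge0.
have kB B : measurable B -> (k%:E * distribution P (Y i0) B =
    \int[P]_(t in setT) (\1_B (Y i0 t) * H t)%:E)%E.
  (* With an indicator at [i0], only indices in [s] still carry arbitrary functions, so the
     induction hypothesis applies to [g']. *)
  move=> mB; pose g' i := if i == i0 then \1_B else g i.
  have g'i0 : g' i0 = \1_B by rewrite /g' eqxx.
  have g'i i : i != i0 -> g' i = g i by rewrite /g' => /negbTE->.
  have mYB : measurable (Y i0 @^-1` B).
    by rewrite -[X in measurable X]setTI; exact: measurable_funP.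
  have IB : (\int[P]_t (g' i0 (Y i0 t))%:E = P (Y i0 @^-1` B))%E.
    by rewrite g'i0 -(setIT (Y i0 @^-1` B)) -integral_indic.
  transitivity (P C * \prod_i \int[P]_t (g' i (Y i t))%:E)%E.
    rewrite kE [in RHS](bigD1 i0)//= IB -muleA; congr (_ * _)%E.
    by rewrite [LHS]muleC; congr (_ * _)%E; apply: eq_bigr => i /g'i ->.
  rewrite -(ih g').
  + apply: eq_integral => t _; congr EFin; rewrite (bigD1 i0)//= g'i0 mulrCA.
    by congr (_ * (_ * _)); apply: eq_bigr => i /g'i ->.
  + move=> i is_; have [->|ii0] := eqVneq i i0; first by exists B.
    by rewrite g'i//; apply: gs; rewrite in_cons negb_or ii0.
  + move=> i; have [->|ii0] := eqVneq i i0; last by rewrite g'i.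
    by rewrite g'i0; exact: measurable_indic.
  + move=> i x; have [->|ii0] := eqVneq i i0; last by rewrite g'i.
    by rewrite g'i0.
  + move=> i; have [->|ii0] := eqVneq i i0; last by rewrite g'i.
    by rewrite IB ltey_eq fin_num_measure.
have mY0 : measurable_fun setT (Y i0) by [].
rewrite (ge0_integral_density_comp measurableT mY0 mH H0 k0 kB (mg i0) (g0 i0)).
by apply: eq_integral => t _; congr EFin; rewrite (bigD1 i0)//= mulrCA.
Qed.

(** * The marginal likelihood *)

(** Inversion is continuous off 0, and every function is measurable on a singleton. *)
Lemma measurable_invr (R : realType) : measurable_fun setT (fun x : R => x^-1).
Proof.
rewrite -(setvU [set 0]); apply/measurable_funU => //; first exact: measurableC.
split; last exact: measurable_fun_set1.
apply: open_continuous_measurable_fun; first by rewrite openC; exact: closed_eq.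
by move=> x; rewrite inE => /eqP x0; exact: inv_continuous.
Qed.

Lemma big_option (S : Type) (idx : S) (op : Monoid.com_law idx) (I : finType)
    (F : option I -> S) :
  \big[op/idx]_o F o = op (F None) (\big[op/idx]_i F (Some i)).
Proof.
rewrite (bigD1 None)//=; congr (op _ _).
rewrite (reindex_omap Some id); last by case.
by apply: eq_bigl => i; rewrite eqxx.
Qed.

(** * Factorization of the likelihood over coordinates, and conjugacy *)

Section Likelihood.
Variables (R : realType) (p : nat) (A : 'I_p -> finType) (n : nat).
Implicit Types (x : 'I_n -> Omega A) (c : Omega A) (j : 'I_p).

(** The contribution of coordinate [j] to the likelihood: each of the [n] observations gives one
    inverse base, and each mismatch with the center gives [expR (- (1 / s))]. *)
Definition coord_likelihood x c j (s : R) : R :=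
  (hamming_base #|A j| s)^-1 ^+ n *
  expR (- ((n%:R - (matches x c j)%:R) / s)).

Lemma likelihoodE x c (sigma : 'I_p -> R) :
  likelihood c sigma x = \prod_j coord_likelihood x c j (sigma j).
Proof.
rewrite /likelihood /hamming_pmf big_split/= prodr_const card_ord -prodfV.
rewrite -prodrXl -expR_sum /coord_likelihood big_split/= -expR_sum.
congr (_ * expR _); rewrite !sumrN; congr (- _).
rewrite exchange_big/=; apply: eq_bigr => j _; rewrite -mulr_suml; congr (_ / _).
by rewrite sumrB sumr_const card_ord natr_sum.
Qed.

Lemma coord_likelihood_ge0 x c j s : (0 < #|A j|)%N -> 0 <= coord_likelihood x c j s.
Proof.
move=> Aj; rewrite mulr_ge0 ?expR_ge0// exprn_ge0// invr_ge0 ltW//.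
exact: hamming_base_gt0.
Qed.

Lemma measurable_coord_likelihood x c j :
  measurable_fun setT (coord_likelihood x c j).
Proof.
have mV := @measurable_invr R.
apply: measurable_funM.
  apply: measurable_funX; apply: (measurableT_comp mV).
  apply: measurable_funD => //; apply: measurable_funM => //.
  by apply: (measurableT_comp mV); exact: measurableT_comp.
apply: measurableT_comp => //; apply: measurable_funN.
exact: measurable_funM.
Qed.

(** Conjugacy: matches are added to [v] and mismatches to [w], so [v + w] grows by [n], the number
    of inverse bases, and [w] by the number of exponential factors. *)
Lemma coord_likelihood_kernel x c j (v w s : R) : (0 < #|A j|)%N ->
  coord_likelihood x c j s * HIG_kernel #|A j| v w s =
  HIG_kernel #|A j| (v + (matches x c j)%:R)
    (w + n%:R - (matches x c j)%:R) s.
Proof.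
move=> Aj; have h0 := hamming_base_gt0 Aj s.
rewrite /coord_likelihood /HIG_kernel exprVn -(powR_invn n (ltW h0)).
set k := (matches x c j)%:R.
rewrite (_ : - (v + k + _) = - n%:R + - (v + w)); last by ring.
rewrite powRD ?(gt_eqF h0) ?implybT//.
rewrite (_ : - ((w + n%:R - k + 1) / s) = - ((n%:R - k) / s) + - ((w + 1) / s)).
  by rewrite expRD; ring.
by ring.
Qed.

Lemma matches_le x c j : (matches x c j <= n)%N.
Proof.
rewrite -[leqRHS]card_ord -sum1_card; apply: leq_sum => i _; exact: leq_b1.
Qed.

End Likelihood.

(** * Expectations under the prior *)

Section Marginal.
Variables (R : realType) (d : measure_display) (T : measurableType d).
Variable P : probability T R.

Lemma integral_HIG_law m (v w : R) (Y : {RV P >-> R}) (g : R -> R) :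
  (0 < m)%N -> 0 < v -> 0 < w -> has_HIG_law m v w Y ->
  measurable_fun setT g -> (forall x, 0 <= g x) ->
  (\int[P]_t (g (Y t))%:E =
   \int[lebesgue_measure]_(s in `]0%R, +oo[) (g s * HIG_density m v w s)%:E)%E.
Proof.
move=> m0 v0 w0 lawY mg g0.
have mge : measurable_fun setT (EFin \o g) by exact/measurable_EFinP.
(* The sign of the constant is read off the integral that it equals. *)
have c0 : 0 <= (HIG_const m v w)^-1.
  by rewrite invr_ge0 -lee_fin -integral_HIG_kernel// integral_HIG_kernel_ge0.
have mD : measurable_fun `](0 : R), +oo[ (HIG_density m v w).
  apply: measurable_funM => //; apply/measurable_EFinP.
  exact: measurable_HIG_kernel.
have D0 s : 0 <= HIG_density m v w s by rewrite mulr_ge0// HIG_kernel_ge0.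
rewrite -(ge0_integral_distribution Y mge); last by move=> u; rewrite lee_fin.
have h B : measurable B -> (1%:E * distribution P Y B =
    \int[lebesgue_measure]_(s in `]0%R, +oo[)
      (\1_B s * HIG_density m v w s)%:E)%E.
  move=> mB; rewrite mul1e; apply: etrans (lawY B mB) _.
  rewrite integral_mkcondl; apply: eq_integral => s _.
  by rewrite epatch_indic/= muleC.
rewrite -[LHS]mul1e.
have mid : measurable_fun `](0 : R), +oo[ (@id R) by exact: measurable_id.
exact: (@ge0_integral_density_comp R _ _ _ _ (@lebesgue_measure R)
  (distribution P Y) _ id _ 1 g (measurable_itv `]0, +oo[) mid mD
  (fun s _ => D0 s) ler01 h mg g0).
Qed.

Context {p : nat} {A : 'I_p -> finType}.
Variables (c : T -> Omega A) (sigma : 'I_p -> {RV P >-> R}).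
Variables (q : forall j, A j -> R) (v w : R).
Hypotheses (v_gt0 : 0 < v) (w_gt0 : 0 < w) (A_gt0 : forall j, (0 < #|A j|)%N).
Hypothesis prior_c : prior c sigma q v w.

Let mcenter (c0 : Omega A) : measurable [set t | c t = c0].
Proof.
have [+ _ _ _ _] := prior_c; apply.
by exists [set c0] => //; rewrite setTI.
Qed.

Lemma prior_center (c0 : Omega A) :
  P [set t | c t = c0] = (\prod_j q (c0 j))%:E.
Proof.
have [_ qE indep _ _] := prior_c.
have := indep (finset.setTfor 'I_p) (fun j => [set t | c t j = c0 j]) _.
rewrite (_ : \bigcap_(i in _) _ = [set t | c t = c0]).
  move=> ->; last by move=> j _; exists [set c0 j] => //; rewrite setTI.
  rewrite -prodEFin; apply: eq_big => [j|j _]; first by rewrite inE.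
  exact: qE.
apply/seteqP; split => t /=.
  by move=> h; apply/ffunP => j; apply: h; rewrite /= inE.
by move=> <- j.
Qed.

(** Joint independence over the full index set [option 'I_p], with [None] split off; this is the
    hypothesis of [integral_prod_independent] for the event that the center is [c0]. *)
Lemma prior_center_scale (c0 : Omega A) (B : 'I_p -> set R) :
  (forall j, measurable (B j)) ->
  P ([set t | c t = c0] `&` \bigcap_j sigma j @^-1` B j) =
  (P [set t | c t = c0] * \prod_j P (sigma j @^-1` B j))%E.
Proof.
move=> mB; have [_ _ _ _ indep] := prior_c.
pose E (o : option 'I_p) : set T :=
  if o is Some j then sigma j @^-1` B j else [set t | c t = c0].
have := indep (finset.setTfor (option 'I_p)) E _.
rewrite (_ : \bigcap_(i in _) _ =
    [set t | c t = c0] `&` \bigcap_j sigma j @^-1` B j); last first.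
  apply/seteqP; split => t /=.
    move=> h; split; first by apply: (h None); rewrite /= inE.
    by move=> j _; apply: (h (Some j)); rewrite /= inE.
  by move=> [h1 h2] [j|] _ //=; exact: h2.
move=> ->.
  rewrite -(big_option _ (fun o => P (E o))).
  by apply: eq_bigl => o; rewrite inE.
move=> [j|] _ /=; first by exists (B j) => //; rewrite setTI.
by exists [set c0] => //; rewrite setTI.
Qed.

Lemma expectation_coord_likelihood n (x : 'I_n -> Omega A) (c0 : Omega A) j :
  (\int[P]_t (coord_likelihood x c0 j (sigma j t))%:E =
   (HIG_const #|A j| (v + (matches x c0 j)%:R)
      (w + n%:R - (matches x c0 j)%:R) / HIG_const #|A j| v w)%:E)%E.
Proof.
have [_ _ _ law _] := prior_c.
rewrite (integral_HIG_law (A_gt0 j) v_gt0 w_gt0 (law j)); last 2 first.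
- exact: measurable_coord_likelihood.
- by move=> s; exact: coord_likelihood_ge0.
(* This keeps the updated [w] positive, so that the kernel integral is known for it. *)
have k_le : (matches x c0 j)%:R <= n%:R :> R by rewrite ler_nat matches_le.
set v' := v + _; set w' := w + _ - _.
have v'0 : 0 < v' by rewrite ltr_wpDr.
have w'0 : 0 < w' by rewrite /w' -addrA ltr_wpDr// subr_ge0.
transitivity (\int[lebesgue_measure]_(s in `]0%R, +oo[)
    ((HIG_const #|A j| v w)^-1%:E * (HIG_kernel #|A j| v' w' s)%:E))%E.
  apply: eq_integral => s _.
  by rewrite -EFinM /HIG_density mulrCA coord_likelihood_kernel.
rewrite ge0_integralZl_EFin//.
- by rewrite integral_HIG_kernel// -EFinM mulrC.
- by move=> s _; rewrite lee_fin HIG_kernel_ge0.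
- exact: measurable_HIG_kernel.
- by rewrite invr_ge0 -lee_fin -integral_HIG_kernel// integral_HIG_kernel_ge0.
Qed.

Lemma marginal_likelihoodE n (x : 'I_n -> Omega A) :
  marginal_likelihood c sigma x =
  (\sum_(c0 : Omega A) \prod_(j < p)
     (q (c0 j) *
      (HIG_const #|A j| (v + (matches x c0 j)%:R)
         (w + n%:R - (matches x c0 j)%:R) /
       HIG_const #|A j| v w)))%:E.
Proof.
(* The sample space is partitioned by the value of the center: at each [t] only the term [c0 = c t]
   survives, and in it the center is a constant. *)
pose L c0 t : R := \1_[set t | c t = c0] t *
  \prod_j coord_likelihood x c0 j (sigma j t).
rewrite /marginal_likelihood.
transitivity (\int[P]_t \sum_(c0 : Omega A) (L c0 t)%:E)%E.
  apply: eq_integral => t _; rewrite sumEFin; congr EFin.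
  rewrite likelihoodE (bigD1 (c t))//= [X in _ + X]big1 ?addr0.
    by rewrite /L indicE mem_set// mul1r.
  move=> c1 /eqP c1t; rewrite /L indicE memNset ?mul0r//= => /esym.
  exact: c1t.
have mL c0 : measurable_fun setT (L c0).
  apply: measurable_funM; first exact: measurable_indic.
  apply: (@measurable_prod _ _ _ _ _ _
    (fun j t => coord_likelihood x c0 j (sigma j t))) => j _.
  exact: (measurableT_comp (measurable_coord_likelihood x c0 j)).
rewrite ge0_integral_sum//; last 2 first.
- by move=> c0; exact/measurable_EFinP.
- move=> c0 t _; rewrite lee_fin mulr_ge0// prodr_ge0// => j _.
  exact: coord_likelihood_ge0.
rewrite -sumEFin; apply: eq_bigr => c0 _.
rewrite (integral_prod_independent (mcenter c0) (prior_center_scale c0)).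
- rewrite prior_center big_split/= EFinM; congr (_ * _)%E.
  by rewrite -prodEFin; apply: eq_bigr => j _; rewrite expectation_coord_likelihood.
- by move=> j; exact: measurable_coord_likelihood.
- by move=> j s; exact: coord_likelihood_ge0.
- by move=> j; rewrite expectation_coord_likelihood ltry.
Qed.

End Marginal.

Theorem proposition3 (R : realType) (p : nat) (A : 'I_p -> finType)
    (v w : R) (q : forall j : 'I_p, A j -> R) (n : nat)
    (p_ge1 : (1 <= p)%N) (m_ge1 : forall j, (1 <= #|A j|)%N)
    (v_gt0 : 0 < v) (w_gt0 : 0 < w) (q_pmf : forall j, is_pmf (q j)) :
  (forall j, (\int[lebesgue_measure]_(s in `]0%R, +oo[)
                (HIG_kernel #|A j| v w s)%:E = (HIG_const #|A j| v w)%:E)%E) /\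
  (forall (d : measure_display) (T : measurableType d) (P : probability T R)
      (c : T -> Omega A) (sigma : 'I_p -> {RV P >-> R})
      (X : 'I_n -> T -> Omega A),
    prior c sigma q v w ->
    iid_hamming_given c sigma X ->
    forall x : 'I_n -> Omega A,
      P [set t | forall i, X i t = x i] = marginal_likelihood c sigma x /\
      marginal_likelihood c sigma x =
      (\sum_(c0 : Omega A) \prod_(j < p)
         (q j (c0 j) *
          (HIG_const #|A j| (v + (matches x c0 j)%:R)
             (w + n%:R - (matches x c0 j)%:R) /
           HIG_const #|A j| v w)))%:E).
Proof.
split; first by move=> j; exact: integral_HIG_kernel.
move=> d T P c sigma X prior_c [_ iid] x; split.
  (* The conditional law is integrated over the whole space, a parameter event as the preimage of
     [setT] under [c]. *)
  rewrite -[X in P X]setIT iid//.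
  by apply: sub_sigma_algebra; left; exists setT => //; rewrite setTI.
exact: marginal_likelihoodE.
Qed.
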